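(* For any talent model that generates a sequence $\{Y_n\}$, there is a purely path dependent model generating a sequence $\{Y'_n\}$ with the same joint distribution as $\{Y_n\}$.
   Context: Talent model: a procedure that generates a sequence of observations $\{Y_n\}_{n\ge1}$, typically taking values in some subset of $\mathbb{R}$ (but not necessarily), whose $n$-th term is $Y_n=f(T,X_n)$ for all $n\ge1$. Here $T$ (the ''talent'') is a random variable drawn from a fixed distribution, $\{X_n\}_{n\ge1}$ (the chance or ''luck'' components) is a sequence of i.i.d. random variables independent of $T$, and $f$ can be any measurable function; $f$ does not depend on $n$. Purely path dependent model: a model with no notion of talent, in which the $n$-th observation depends on luck and on the values of the previous observations, that is, $Y_n=g_n(Y_1,\ldots,Y_{n-1},X_n)$ for all $n\ge1$ (so $Y_1=g_1(X_1)$). Here $\{X_n\}_{n\ge1}$ is an i.i.d. sequence and each $g_n$ can be any measurable function. The i.i.d. sequences used in the two models need not be the same. ''Same joint distribution'' refers to the distributions of the entire sequences, not only of their individual terms.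
   Formalization: The observations are assumed to take values in a standard Borel space (isomorphic to a Borel subset of the reals; real-valued observations are included), since the claim fails for observations in arbitrary measurable spaces. *)

(* Defs.v *)
From HB Require Import structures.
From mathcomp Require Export all_boot all_order all_algebra.
From mathcomp Require Export finmap.
From mathcomp Require Export all_classical all_reals all_analysis.

Set Implicit Arguments.
Unset Strict Implicit.
Unset Printing Implicit Defensive.

Local Open Scope classical_set_scope.
Local Open Scope ring_scope.

(* Generators of the product sigma-algebra on E^nat: its elements are the sets
   constraining one coordinate.  This is the coarsest sigma-algebra making every
   coordinate measurable, so it carries the law of an entire sequence. *)
Definition coordinate_sets d (E : measurableType d) : set (set (nat -> E)) :=
  [set A | exists n (B : set E), measurable B /\ A = [set s | B (s n)]].

Definition seq_space d (E : measurableType d) :=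
  g_sigma_algebraType (@coordinate_sets d E).

Definition path_of Omega d (E : measurableType d) (X : nat -> Omega -> E)
  : Omega -> seq_space E := fun w n => X n w.

Section random_sequences.
Context (R : realType) d (Omega : measurableType d) (P : probability Omega R)
  d' (S : measurableType d') (X : nat -> {RV P >-> S}).

Definition mutually_independent :=
  forall (J : {fset nat}) (B : nat -> set S), (forall i, measurable (B i)) ->
    P (\bigcap_(i in [set` J]) (X i @^-1` B i))
      = (\prod_(i <- J) P (X i @^-1` B i))%E.

Definition identically_distributed :=
  forall i j (B : set S), measurable B ->
    distribution P (X i) B = distribution P (X j) B.

Definition iid := mutually_independent /\ identically_distributed.

(* Independence of T from the whole sequence X, not merely from each X n. *)
Definition independent_of_sequence d'' (S' : measurableType d'')
    (T : {RV P >-> S'}) :=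
  forall (B : set S') (A : set (seq_space S)), measurable B -> measurable A ->
    P (T @^-1` B `&` path_of X @^-1` A)
      = (P (T @^-1` B) * P (path_of X @^-1` A))%E.

End random_sequences.

(* Observations are indexed from 0: index n stands for the (n+1)-st one.  Here
   and in path_model, the sample space and the spaces in which talent and luck
   take their values are part of the model and may be any measurable spaces. *)
Record talent_model (R : realType) d (E : measurableType d) := TalentModel {
  tm_dOmega : measure_display;
  tm_Omega : measurableType tm_dOmega;
  tm_P : probability tm_Omega R;
  tm_dTalent : measure_display;
  tm_Talent : measurableType tm_dTalent;
  tm_dLuck : measure_display;
  tm_Luck : measurableType tm_dLuck;
  tm_T : {RV tm_P >-> tm_Talent};
  tm_X : nat -> {RV tm_P >-> tm_Luck};
  tm_f : tm_Talent * tm_Luck -> E;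
  tm_X_iid : iid tm_X;
  tm_X_indep_T : independent_of_sequence tm_X tm_T;
  tm_f_measurable : measurable_fun setT tm_f
}.

Definition tm_Y (R : realType) d (E : measurableType d) (M : talent_model R E)
    (n : nat) (w : tm_Omega M) : E :=
  tm_f (tm_T M w, tm_X M n w).
Arguments tm_Y {R d E} M n w.

(* pm_Y is determined by pm_g and pm_X: pm_YE is its recursive definition.  The
   update pm_g n reads the n earlier observations, in order, and one fresh luck
   component; pm_g 0 only reads the latter, 0.-tuple E being a singleton. *)
Record path_model (R : realType) d (E : measurableType d) := PathModel {
  pm_dOmega : measure_display;
  pm_Omega : measurableType pm_dOmega;
  pm_P : probability pm_Omega R;
  pm_dLuck : measure_display;
  pm_Luck : measurableType pm_dLuck;
  pm_X : nat -> {RV pm_P >-> pm_Luck};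
  pm_g : forall n : nat, n.-tuple E * pm_Luck -> E;
  pm_Y : nat -> pm_Omega -> E;
  pm_X_iid : iid pm_X;
  pm_g_measurable : forall n, measurable_fun setT (@pm_g n);
  pm_YE : forall n w, pm_Y n w = @pm_g n ([tuple pm_Y i w | i < n], pm_X n w)
}.
Arguments pm_Y {R d E} p n _.

Definition same_joint_distribution (R : realType) d (E : measurableType d)
    d1 (Omega1 : measurableType d1) (P1 : probability Omega1 R)
    (Y1 : nat -> Omega1 -> E)
    d2 (Omega2 : measurableType d2) (P2 : probability Omega2 R)
    (Y2 : nat -> Omega2 -> E) :=
  forall A : set (seq_space E), measurable A ->
    P1 (path_of Y1 @^-1` A) = P2 (path_of Y2 @^-1` A).

(* E is isomorphic, as a measurable space, to a Borel subset of R: phi is a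
   bijection onto its range, which is Borel since setT is measurable, and phi
   and its inverse are measurable.  By Kuratowski's theorem these are exactly
   the standard Borel spaces.  Some such restriction is unavoidable, as a path
   dependent model provides regular conditional distributions of each
   observation given the previous ones, and these need not exist in E. *)
Definition standard_borel (R : realType) d (E : measurableType d) :=
  exists phi : E -> R,
    [/\ measurable_fun setT phi, injective phi
      & forall A : set E, measurable A -> measurable (phi @` A)].

(* Main.v *)
From HB Require Import structures.
Require Import Defs.
From mathcomp Require Import measurable_realfun lra.

(** Only the joint law of the observations matters: every sequence (Y n) of
    random elements of a standard Borel space has the law of a path dependent
    sequence, and the talent structure serves only to make each Y n measurable.

    The heart is noise outsourcing ([noise_outsourcing]): given V and Y on one
    probability space, there is a measurable g such that (V, g (V, u)) has the
    law of (V, Y) when u is uniform on [0, 1] and independent of V.  For Y with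
    values in the extended reals, g (v, _) is the quantile function of the
    conditional law of Y given V = v.  Conditional laws are not needed as such:
    for each x take the Radon-Nikodym derivative of the measure P (V in A, Y > x)
    with respect to the law of V, and let g (v, u) be the supremum of the
    rational x at which the derivative at v exceeds u.  A standard Borel space
    is a measurable retract of the extended reals, which transfers the result.

    Applied to V = (Y 0, ..., Y (n-1)) and Y n it yields the update g n.  What
    remains is an i.i.d. sequence of uniform variables.  Noise outsourcing
    provides it too: as R * R is a retract of R, the product of two uniform laws
    is the image of the uniform law under some s : R -> R * R
    ([exists_uniform_split]).  Applying s to a uniform number yields two
    independent ones: the first component is the luck of the present period,
    and the second is the reservoir, split again in the next period.

    By induction on n, the simulated past and the reservoir at time n are
    independent, the past has the law of (Y 0, ..., Y (n-1)) and the reservoir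
    is uniform ([sim_past_law]).  Laws of all finite pasts determine the law of
    the sequence ([same_law_history]). *)

Set Implicit Arguments.
Unset Strict Implicit.
Unset Printing Implicit Defensive.

Import Order.TTheory GRing.Theory Num.Def Num.Theory.
Import numFieldTopology.Exports.

Local Open Scope classical_set_scope.
Local Open Scope ring_scope.

(** * Laws determined by pi-systems *)

Lemma measurable_preimageT d (E : measurableType d) d' (F : measurableType d')
    (f : E -> F) (A : set F) :
  measurable_fun setT f -> measurable A -> measurable (f @^-1` A).
Proof. by move=> mf mA; rewrite -[_ @^-1` _]setTI; exact: mf. Qed.

(** Adding the whole space to a pi-system keeps it one, so equality of the total
    masses replaces an exhaustion of the space by members of G. *)
Lemma finite_measure_unique (R : realType) d (E : measurableType d)
    (G : set (set E)) (m1 m2 : {measure set E -> \bar R}) :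
  @measurable _ E = <<s G >> -> setI_closed G ->
  (m1 setT < +oo)%E -> m1 setT = m2 setT ->
  (forall A, G A -> m1 A = m2 A) ->
  forall A, measurable A -> m1 A = m2 A.
Proof.
move=> mG GI m1oo mT m12.
pose G' := G `|` [set setT].
apply: (@measure_unique _ _ _ G' (fun=> setT)).
- apply/seteqP; split => A.
    by rewrite mG; apply: sub_smallest2r; [exact: smallest_sigma_algebra|left].
  apply: smallest_sub; first exact: sigma_algebra_measurable.
  by move=> B [GB|->//]; rewrite mG; exact: sub_sigma_algebra.
- move=> A B [GA|->] [GB|->]; rewrite ?setTI ?setIT;
    [left|left|left|right] => //.
  exact: GI.
- by move=> _; right.
- by rewrite bigcup_const.
- by move=> A [/m12//|->].
- by [].
Qed.

(** The canonical measure structure on an image measure cannot be inferred from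
    the map alone, as it depends on the proof of measurability. *)
Definition law_of (R : realType) d (E : measurableType d)
    d1 (T1 : measurableType d1) (m : {measure set T1 -> \bar R}) (X : T1 -> E)
    (mX : measurable_fun setT X) : {measure set E -> \bar R} :=
  measure_function_pushforward__canonical__measure_function_Measure m mX.

Lemma same_law_pi_system (R : realType) d (E : measurableType d)
    d1 (T1 : measurableType d1) (P1 : probability T1 R) (X1 : T1 -> E)
    d2 (T2 : measurableType d2) (P2 : probability T2 R) (X2 : T2 -> E)
    (G : set (set E)) :
  measurable_fun setT X1 -> measurable_fun setT X2 ->
  @measurable _ E = <<s G >> -> setI_closed G ->
  (forall A, G A -> P1 (X1 @^-1` A) = P2 (X2 @^-1` A)) ->
  forall A, measurable A -> P1 (X1 @^-1` A) = P2 (X2 @^-1` A).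
Proof.
move=> mX1 mX2 mG GI PG.
have mT1 : law_of P1 mX1 setT = 1%E by exact: probability_setT.
have mT2 : law_of P2 mX2 setT = 1%E by exact: probability_setT.
apply: (@finite_measure_unique _ _ _ G (law_of P1 mX1) (law_of P2 mX2)) => //.
  by rewrite mT1 ltry.
by rewrite mT1 mT2.
Qed.

Lemma same_law_prod (R : realType) d (E : measurableType d)
    d' (F : measurableType d')
    d1 (T1 : measurableType d1) (P1 : probability T1 R) (X1 : T1 -> E * F)
    d2 (T2 : measurableType d2) (P2 : probability T2 R) (X2 : T2 -> E * F) :
  measurable_fun setT X1 -> measurable_fun setT X2 ->
  (forall A B, measurable A -> measurable B ->
    P1 (X1 @^-1` (A `*` B)) = P2 (X2 @^-1` (A `*` B))) ->
  forall D, measurable D -> P1 (X1 @^-1` D) = P2 (X2 @^-1` D).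
Proof.
move=> mX1 mX2 PX.
apply: (same_law_pi_system mX1 mX2 (measurable_prod_measurableType E F)).
  move=> _ _ [A mA [B mB <-]] [A' mA' [B' mB' <-]].
  exists (A `&` A'); first exact: measurableI.
  by exists (B `&` B'); [exact: measurableI|rewrite setXI].
by move=> _ [A mA [B mB <-]]; exact: PX.
Qed.

(** For fixed A, the two finite measures P (X in A, Y in _) agree on the rays
    ]x, +oo], a pi-system generating the Borel sets, and have equal masses because
    X1 and X2 have the same law. *)
Lemma same_law_prod_ereal (R : realType) d (E : measurableType d)
    d1 (T1 : measurableType d1) (P1 : probability T1 R)
    (X1 : T1 -> E) (Y1 : T1 -> \bar R)
    d2 (T2 : measurableType d2) (P2 : probability T2 R)
    (X2 : T2 -> E) (Y2 : T2 -> \bar R) :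
  measurable_fun setT X1 -> measurable_fun setT Y1 ->
  measurable_fun setT X2 -> measurable_fun setT Y2 ->
  (forall A, measurable A -> P1 (X1 @^-1` A) = P2 (X2 @^-1` A)) ->
  (forall A x, measurable A ->
    P1 (X1 @^-1` A `&` [set t | (x%:E < Y1 t)%E])
    = P2 (X2 @^-1` A `&` [set t | (x%:E < Y2 t)%E])) ->
  forall D, measurable D ->
    P1 ((fun t => (X1 t, Y1 t)) @^-1` D) = P2 ((fun t => (X2 t, Y2 t)) @^-1` D).
Proof.
move=> mX1 mY1 mX2 mY2 PX PXY.
apply: same_law_prod; [exact: measurable_fun_pair..|] => A B mA mB.
have mX1A := measurable_preimageT mX1 mA.
have mX2A := measurable_preimageT mX2 mA.
pose m1 := law_of (mrestr P1 mX1A) mY1.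
pose m2 := law_of (mrestr P2 mX2A) mY2.
have m1E C : m1 C = P1 (X1 @^-1` A `&` Y1 @^-1` C) by rewrite setIC.
have m2E C : m2 C = P2 (X2 @^-1` A `&` Y2 @^-1` C) by rewrite setIC.
suff m12 : m1 B = m2 B by move: m12; rewrite m1E m2E.
apply: (@finite_measure_unique _ _ _ (@ErealGenOInfty.G R) m1 m2) => //.
- exact: ErealGenOInfty.measurableE.
- move=> _ _ [x ->] [y ->]; exists (maxr x y).
  apply/seteqP; split => z /=; rewrite !in_itv/= !andbT EFin_max gt_max.
    by case=> -> ->.
  by case/andP.
- rewrite m1E preimage_setT setIT (le_lt_trans _ (ltry 1%R))//.
  exact: probability_le1.
- by rewrite m1E m2E !preimage_setT !setIT PX.
- move=> _ [x ->]; rewrite m1E m2E.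
  have itvE T (Y : T -> \bar R) :
      Y @^-1` `]x%:E, +oo[ = [set t | (x%:E < Y t)%E].
    by apply/seteqP; split => t /=; rewrite in_itv/= andbT.
  by rewrite !itvE PXY.
Qed.

(** * The uniform law on the unit interval *)

Section unif01.
Context (R : realType).

(** The uniform law lives on a copy of R with the Borel sets but another display;
    the identity transports it to R itself. *)
Definition to_R (x : measurableTypeR R) : R := x.

Let measurable_to_R : measurable_fun setT to_R.
Proof. by move=> _ A mA; rewrite setTI. Qed.

HB.instance Definition _ := isMeasurableFun.Build _ _ _ _ to_R measurable_to_R.

Definition unif01 : probability R R :=
  distribution (uniform_prob (@ltr01 R)) to_R.

Lemma unif01_lt (c : \bar R) : (0 <= c <= 1)%E ->
  unif01 [set u | (u%:E < c)%E] = c.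
Proof.
case: c => [r /andP[]| |]; [|by rewrite leye_eq andbF|by rewrite leeNy_eq].
rewrite !lee_fin => r0 r1.
rewrite -[LHS]/(uniform_prob (@ltr01 R) (to_R @^-1` _)) /uniform_prob.
rewrite integral_uniform_pdf.
have -> : to_R @^-1` [set u | (u%:E < r%:E)%E] `&` `[0%R, 1%R] = `[0%R, r[%classic.
  apply/seteqP; split => x /=; rewrite !in_itv/= lte_fin.
    by case=> xr /andP[-> _].
  by move=> /andP[-> xr]; split => //=; rewrite (le_trans (ltW xr)).
rewrite (eq_integral (cst 1%E)).
  rewrite integral_cst//= lebesgue_measure_itv/= mul1e lte_fin.
  by case: ltgtP r0 => // [_|<-]; rewrite ?sube0.
move=> x; rewrite inE/= in_itv/= => /andP[x0 xr].
by rewrite /uniform_pdf x0 (le_trans (ltW xr) r1)/= subr0 invr1.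
Qed.

End unif01.

(** * Conditional probabilities given a random element *)

(** On the set where g < f the two integrals over any measurable subset agree,
    so f = g almost everywhere there, and the set is null. *)
Lemma ae_le_of_integral_le (R : realType) d (T : measurableType d)
    (mu : {measure set T -> \bar R}) (f g : T -> \bar R) :
  mu.-integrable setT f -> mu.-integrable setT g ->
  (forall A, measurable A ->
    (\int[mu]_(x in A) f x <= \int[mu]_(x in A) g x)%E) ->
  {ae mu, forall x, (f x <= g x)%E}.
Proof.
move=> fi gi fg.
have mf := measurable_int _ fi; have mg := measurable_int _ gi.
pose D := [set x | (g x < f x)%E].
have mD : measurable D by rewrite -[D]setTI; exact: measurable_lte.
have fgD : ae_eq mu D f g.
  apply: integral_ae_eq => //.
  - exact: integrableS fi.
  - exact: measurable_funS mg.
  move=> A AD mA; apply/eqP; rewrite eq_le fg//=.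
  apply: le_integral => //; [exact: integrableS gi|exact: integrableS fi|].
  by move=> x /[!inE] Ax; exact/ltW/AD.
apply: filterS fgD => x /= fgD; rewrite leNgt; apply/negP => gf.
by move: (gf); rewrite fgD ?ltxx.
Qed.

(** f is a version of the conditional probability of D given V.  Truncating the
    Radon-Nikodym derivative at 1 gives the bounds everywhere, not only almost
    everywhere, so that f v is exactly the uniform measure of [0, f v[. *)
Lemma conditional_density (R : realType) d (Om : measurableType d)
    (P : probability Om R) d' (S : measurableType d') (V : {RV P >-> S})
    (D : set Om) (mD : measurable D) : exists f : S -> \bar R,
  [/\ measurable_fun setT f, forall v, (0 <= f v <= 1)%E &
      forall A, measurable A ->
        P (V @^-1` A `&` D) = (\int[distribution P V]_(v in A) f v)%E].
Proof.
pose nu : {measure set S -> \bar R} :=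
  measure_function_pushforward__canonical__measure_function_Measure
    (mrestr P mD) (measurable_funPT V).
have nu_fin : fin_num_fun nu.
  move=> A mA; apply: (fin_num_measure (mrestr P mD)) => //.
  exact: measurable_funPTI.
pose nufin := Measure_isFinite.Build _ _ _ nu nu_fin.
pose nu' : {finite_measure set S -> \bar R} := HB.pack (Measure.sort nu) nufin.
have /radon_nikodym_finite[f [f0 fi fE]] : nu' `<< distribution P V.
  apply/null_content_dominatesP => A mA VA0; apply/eqP.
  have mVA : measurable (V @^-1` A) by exact: measurable_funPTI.
  rewrite -measure_le0 -[leRHS]VA0.
  by apply: (le_measure P); rewrite ?inE//; exact: measurableI.
have mf := measurable_int _ fi.
have f1 : {ae distribution P V, forall v, (f v <= 1)%E}.
  apply: (ae_le_of_integral_le fi).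
    exact: (finite_measure_integrable_cst _ 1%R).
  move=> A mA; rewrite -fE// integral_cst// mul1e.
  have mVA : measurable (V @^-1` A) by exact: measurable_funPTI.
  by apply: (le_measure P); rewrite ?inE//; exact: measurableI.
exists (fun v => mine (f v) 1%E); split.
- exact: measurable_mine.
- by move=> v; rewrite le_min f0 lee01 ge_min lexx orbT.
- move=> A mA; transitivity (\int[distribution P V]_(v in A) f v)%E.
    by rewrite -fE.
  apply: ae_eq_integral => //.
  + exact: measurable_funTS.
  + by apply: measurable_funTS; exact: measurable_mine.
  + by apply: filterS f1 => v fv _; rewrite min_l.
Qed.

(** * Rational cuts *)

Section rat_seq.
Context (R : realType).

Definition rat_seq (n : nat) : R := ratr (odflt 0%Q (choice.unpickle n)).

Lemma rat_seq_dense (x y : R) : x < y -> exists n, x < rat_seq n < y.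
Proof.
move=> /rat_in_itvoo[q]; rewrite in_itv/= => xqy.
by exists (choice.pickle q); rewrite /rat_seq choice.pickleK.
Qed.

(** Q selects rationals by their index; a real number is the cut_sup of the
    rationals below it. *)
Definition cut_sup (Q : set nat) : \bar R :=
  ereal_sup [set (rat_seq n)%:E | n in Q].

Lemma cut_sup_gt (Q : set nat) x :
  (x%:E < cut_sup Q)%E <-> exists2 n, x < rat_seq n & Q n.
Proof.
split=> [/ereal_sup_gt[_ [n Qn <-]]|[n xn Qn]].
  by rewrite lte_fin => xn; exists n.
by apply/ereal_sup_gtP; exists (rat_seq n)%:E; [exists n|rewrite lte_fin].
Qed.

Lemma cut_supK (x : R) : cut_sup [set n | rat_seq n < x] = x%:E.
Proof.
apply/eqP; rewrite eq_le; apply/andP; split.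
  by apply: ge_ereal_sup => _ [n /= nx <-]; rewrite lee_fin ltW.
rewrite leNgt; apply/negP => Qx.
have [y yx Qy] : exists2 y, y < x & (cut_sup [set n | (rat_seq n < x)%R] <= y%:E)%E.
  move: Qx; case: cut_sup => [y| |]; rewrite ?lte_fin ?ltNge ?leey// => yx.
    by exists y => //; rewrite ltNge.
  by exists (x - 1); rewrite ?leNye// ltrBlDr ltrDl.
have [n /andP[yn nx]] := rat_seq_dense yx.
by move: Qy; rewrite leNgt => /negP; apply; apply/cut_sup_gt; exists n.
Qed.

(** cut_sup (Q t) exceeds x when one of countably many events holds. *)
Lemma measurable_cut_sup d (T : measurableType d) (Q : T -> set nat) :
  (forall n, measurable [set t | Q t n]) ->
  measurable_fun setT (fun t => cut_sup (Q t)).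
Proof.
move=> mQ mT; apply: (measurability _ (ErealGenOInfty.measurableE R)) => //.
move=> _ [_ [x ->] <-].
rewrite setTI (_ : _ @^-1` _ = \bigcup_(n in [set n | x < rat_seq n])
    [set t | Q t n]); first by apply: bigcup_measurable => n _; exact: mQ.
apply/seteqP; split => t /=; rewrite in_itv/= andbT.
  by move=> /cut_sup_gt[n ? ?]; exists n.
by move=> [n ? ?]; apply/cut_sup_gt; exists n.
Qed.

End rat_seq.

(** * Noise outsourcing *)

Section noise_outsourcing_ereal.
Context (R : realType) d (Om : measurableType d) (P : probability Om R)
  d' (S : measurableType d') (V : {RV P >-> S}) (Y : Om -> \bar R)
  (mY : measurable_fun setT Y).

Local Notation mu := (distribution P V).

Let mYlt x : measurable [set w | (x%:E < Y w)%E].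
Proof. by rewrite -[X in measurable X]setTI; exact: measurable_lte. Qed.

(* surv x v is the conditional probability that Y > x given V = v. *)
Let surv_spec x : {f : S -> \bar R |
  [/\ measurable_fun setT f, forall v, (0 <= f v <= 1)%E &
      forall A, measurable A -> P (V @^-1` A `&` [set w | (x%:E < Y w)%E])
        = (\int[mu]_(v in A) f v)%E]}.
Proof. exact/cid/conditional_density. Qed.

Let surv x : S -> \bar R := sval (surv_spec x).

Let msurv x : measurable_fun setT (surv x).
Proof. by rewrite /surv; case: surv_spec => f []. Qed.

Let surv01 x v : (0 <= surv x v <= 1)%E.
Proof. by rewrite /surv; case: surv_spec => f []. Qed.

Let survE x A : measurable A ->
  P (V @^-1` A `&` [set w | (x%:E < Y w)%E]) = (\int[mu]_(v in A) surv x v)%E.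
Proof. by move=> mA; rewrite /surv; case: surv_spec => f /= [_ _ ->]. Qed.

Let surv_integrable x : mu.-integrable setT (surv x).
Proof.
apply: (@le_integrable _ _ _ mu _ _ _ (EFin \o cst 1)) => //.
  move=> v _; have /andP[s0 s1] := surv01 x v.
  by rewrite !gee0_abs// lee_fin.
exact: finite_measure_integrable_cst.
Qed.

(* Monotonicity in the threshold holds only almost everywhere, and simultaneously
   only for countably many thresholds: hence the restriction to rationals. *)
Let surv_ae_le x : {ae mu, forall v, forall n, x < rat_seq R n ->
  (surv (rat_seq R n) v <= surv x v)%E}.
Proof.
apply: ae_foralln => n; have [xn|nx] := ltP x (rat_seq R n); last first.
  by apply: aeW.
suff H : {ae mu, forall v, (surv (rat_seq R n) v <= surv x v)%E}.
  by apply: filterS H => v H _.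
apply: ae_le_of_integral_le => // A mA; rewrite -!survE//.
have mVA : measurable (V @^-1` A) by exact: measurable_funPTI.
apply: (le_measure P); rewrite ?inE; [exact: measurableI..|].
by apply: setIS => w /=; apply: lt_trans; rewrite lte_fin.
Qed.

(* u < surv x v says that x lies below the quantile of level u, counted from
   above, of the conditional law given V = v. *)
Let G (z : S * R) : \bar R :=
  cut_sup R [set n | (z.2%:E < surv (rat_seq R n) z.1)%E].

Let mG : measurable_fun setT G.
Proof.
apply: measurable_cut_sup => n; rewrite -[X in measurable X]setTI.
apply: measurable_lte => //; first exact/measurable_EFinP.
exact: measurableT_comp.
Qed.

Let law_sections (A : set S) (x : R) : measurable A ->
  (mu \x unif01 R)%E ([set z | A z.1] `&` [set z | (x%:E < G z)%E]) =
  (\int[mu]_(v in A) unif01 R [set u | (x%:E < G (v, u))%E])%E.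
Proof.
move=> mA; rewrite /product_measure1 [RHS]integral_mkcond.
apply: eq_integral => v _; rewrite patchE /=; case: ifPn => vA.
  congr (unif01 R _); apply/seteqP; split => u /=; rewrite /xsection /= inE/=.
    by case.
  by move=> ?; split => //; rewrite inE in vA.
rewrite [X in unif01 R X](_ : _ = set0) ?measure0//.
apply/seteqP; split => u //=; rewrite /xsection /= inE /= => -[].
by rewrite notin_setE in vA.
Qed.

(** On rays: G (v, u) > x iff u < surv q v for some rational q > x.  Such u have
    measure at least surv q v for each such q, and at most surv x v for almost
    every v; integrating over v in A bounds the probability that V is in A and
    G > x between P (V in A, Y > q) and P (V in A, Y > x).  The lower bound tends
    to the upper one as q decreases to x. *)
Lemma noise_outsourcing_ereal : exists G : S * R -> \bar R,
  measurable_fun setT G /\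
  forall D, measurable D -> P ((fun w => (V w, Y w)) @^-1` D)
    = (mu \x unif01 R)%E ((fun z => (z.1, G z)) @^-1` D).
Proof.
exists G; split => //.
apply: same_law_prod_ereal => // [A mA|A x mA].
  rewrite (_ : fst @^-1` A = A `*` setT); last first.
    by apply/seteqP; split => [[v u]|[v u] []].
  by rewrite [RHS]product_measure1E// [X in (_ * X)%E]probability_setT mule1.
have mVA : measurable (V @^-1` A) by exact: measurable_funPTI.
rewrite [RHS](law_sections x mA).
have mGx : measurable [set z | (x%:E < G z)%E].
  by rewrite -[X in measurable X]setTI; exact: measurable_lte.
have xsecE v : xsection [set z | (x%:E < G z)%E] v = [set u | (x%:E < G (v, u))%E].
  by apply/seteqP; split => u; rewrite /xsection /= inE.
have msecv v : measurable [set u | (x%:E < G (v, u))%E].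
  by rewrite -xsecE; exact: measurable_xsection.
have mlt c : measurable [set u : R | (u%:E < c)%E].
  by rewrite -[X in measurable X]setTI; exact: measurable_lte.
have msec : measurable_fun setT (fun v => unif01 R [set u | (x%:E < G (v, u))%E]).
  have := measurable_fun_xsection (unif01 R) mGx.
  by apply: eq_measurable_fun => v _ /=; rewrite xsecE.
apply/eqP; rewrite eq_le; apply/andP; split.
  have key y : x < y -> (P (V @^-1` A `&` [set w | (y%:E < Y w)%E]) <=
      \int[mu]_(v in A) unif01 R [set u | (x%:E < G (v, u))%E])%E.
    move=> /rat_seq_dense[n /andP[xn ny]].
    apply: (@le_trans _ _ (P (V @^-1` A `&` [set w | ((rat_seq R n)%:E < Y w)%E]))).
      apply: (le_measure P); rewrite ?inE; [exact: measurableI..|].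
      by apply: setIS => w /=; apply: lt_trans; rewrite lte_fin.
    rewrite survE//; apply: ge0_le_integral => //.
    - by move=> v _; case/andP: (surv01 (rat_seq R n) v).
    - exact: measurable_funTS.
    - exact: measurable_funTS.
    move=> v _; rewrite -[leLHS]unif01_lt//.
    apply: (le_measure (unif01 R)); rewrite ?inE// => u /= un.
    by apply/cut_sup_gt; exists n.
  pose F k := V @^-1` A `&` [set w | ((x + k.+1%:R^-1)%:E < Y w)%E].
  have mF k : measurable (F k) by exact: measurableI.
  have FE : V @^-1` A `&` [set w | (x%:E < Y w)%E] = \bigcup_k F k.
    rewrite /F -setI_bigcupr; congr setI; apply/seteqP; split => w /=.
      case Yw : (Y w) => [y| |] xy; last by move: xy; rewrite ltNge leNye.
        move: xy; rewrite lte_fin -subr_gt0 => xy.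
        have [k _ ky] := near_infty_natSinv_lt (PosNum xy).
        by exists k => //=; rewrite Yw lte_fin -ltrBrDl; exact: (ky k (leqnn k)).
      by exists 0%N => //=; rewrite Yw ltry.
    move=> [k _ /=]; apply: lt_trans; rewrite lte_fin ltrDl invr_gt0.
    by rewrite ltr0n.
  rewrite FE; apply: (cvge_to_le (nondecreasing_cvg_mu (mu := P) mF _ _)).
  - exact: bigcupT_measurable.
  - move=> m n mn; apply/subsetPset; apply: setIS => w /=; apply: le_lt_trans.
    by rewrite lee_fin lerD2l lef_pV2 ?posrE// ler_nat.
  - by apply: nearW => k /=; apply: key; rewrite ltrDl invr_gt0.
rewrite survE//; apply: ae_ge0_le_integral => //.
- exact: measurable_funTS.
- by move=> v _; case/andP: (surv01 x v).
- exact: measurable_funTS.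
- apply: filterS (surv_ae_le x) => v vle _.
  rewrite -[leRHS]unif01_lt//.
  apply: (le_measure (unif01 R)); rewrite ?inE// => u /= /cut_sup_gt[n xn un].
  exact: lt_le_trans (vle n xn).
Qed.
End noise_outsourcing_ereal.

(** * Measurable retracts of the extended real line *)

(** E is a measurable retract of the extended real line: a law on E can then be
    simulated on the line and mapped back. *)
Definition ereal_retract (R : realType) d (E : measurableType d) :=
  exists (phi : E -> \bar R) (psi : \bar R -> E),
    [/\ measurable_fun setT phi, measurable_fun setT psi & cancel phi psi].

(** psi is the inverse of phi, extended by a constant outside the range of phi,
    which is a Borel set. *)
Lemma standard_borel_retract (R : realType) d (E : measurableType d) :
  standard_borel R E -> ereal_retract R E.
Proof.
move=> [phi [mphi phi_inj phi_im]].
pose inv (x : R) : E :=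
  if pselect (exists e, phi e = x) is left h then sval (cid h) else point.
have invK : cancel phi inv.
  move=> e; rewrite /inv; case: pselect => [h|[]]; last by exists e.
  by apply: phi_inj; case: cid.
have minv : measurable_fun setT inv.
  move=> _ A mA; rewrite setTI.
  rewrite (_ : inv @^-1` A = phi @` A `|` (if point \in A then ~` range phi else set0)).
    apply: measurableU; first exact: phi_im.
    by case: ifP => // _; apply: measurableC; exact: phi_im.
  apply/seteqP; split => x /=.
    have [[e <-]|nx] := pselect (exists e, phi e = x).
      by rewrite invK => Ae; left; exists e.
    rewrite /inv; case: pselect => // _ Ap; right.
    by rewrite (mem_set Ap) => -[e _ ex]; apply: nx; exists e.
  case=> [[e Ae <-]|]; first by rewrite invK.
  case: ifP => // /set_mem Ap nx; rewrite /inv; case: pselect => // -[e ex].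
  by case: nx; exists e.
exists (EFin \o phi), (inv \o fine); split.
- exact/measurable_EFinP.
- exact: measurableT_comp.
- by move=> e /=; rewrite invK.
Qed.

Section noise_outsourcing.
Context (R : realType) d (Om : measurableType d) (P : probability Om R)
  d' (S : measurableType d') (V : {RV P >-> S})
  d'' (E : measurableType d'') (Y : Om -> E) (mY : measurable_fun setT Y).

(** Simulate phi (Y), then apply psi. *)
Lemma noise_outsourcing : ereal_retract R E -> exists g : S * R -> E,
  measurable_fun setT g /\
  forall D, measurable D -> P ((fun w => (V w, Y w)) @^-1` D)
    = (distribution P V \x unif01 R)%E ((fun z => (z.1, g z)) @^-1` D).
Proof.
move=> [phi [psi [mphi mpsi phiK]]].
have [G [mG GE]] := noise_outsourcing_ereal V (measurableT_comp mphi mY).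
exists (psi \o G); split; first exact: measurableT_comp.
move=> D mD; pose D' := [set z | D (z.1, psi z.2)].
have mD' : measurable D'.
  apply: (measurable_preimageT (f := fun z => (z.1, psi z.2))) mD.
  by apply: measurable_fun_pair => //; exact: measurableT_comp.
rewrite -[RHS](GE D' mD'); congr (P _).
by apply/seteqP; split => w; rewrite /D' /= phiK.
Qed.

End noise_outsourcing.

Section ternary_code.
Context (R : realType).
Implicit Types (b : nat -> bool) (x : R).

(** Base 3 with digits 0 and 1 only: what follows a digit contributes at most 1/2,
    so the digit can be read off by comparison with 1, without the ambiguity of
    binary expansions. *)
Definition code_part b (n : nat) : R := \sum_(k < n) (b k)%:R / 3 ^+ k.

Lemma code_partS b n :
  code_part b n.+1 = (b 0)%:R + code_part (b \o S) n / 3.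
Proof.
rewrite /code_part big_ord_recl expr0 divr1 mulr_suml; congr (_ + _).
by apply: eq_bigr => k _; rewrite /= /bump add1n exprSr invfM mulrA.
Qed.

Lemma code_part_le b n : code_part b n <= 3 / 2.
Proof.
elim: n b => [|n IH] b; first by rewrite /code_part big_ord0; lra.
by rewrite code_partS; have := IH (b \o S); case: (b 0) => /=; lra.
Qed.

Lemma code_part_ge0 b n : 0 <= code_part b n.
Proof. by apply: sumr_ge0 => k _; rewrite mulr_ge0. Qed.

Lemma is_cvg_code_part b : cvgn (code_part b).
Proof.
apply: nondecreasing_is_cvgn.
  apply/nondecreasing_seqP => n; rewrite /code_part big_ord_recr /= lerDl.
  by rewrite mulr_ge0.
by exists (3 / 2) => _ [n _ <-]; exact: code_part_le.
Qed.

Lemma measurable_bool_natr : measurable_fun setT (fun c : bool => c%:R : R).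
Proof. by []. Qed.

Definition code b : R := limn (code_part b).

Lemma code_ge0 b : 0 <= code b.
Proof.
apply: limr_ge; first exact: is_cvg_code_part.
by apply: nearW => n; exact: code_part_ge0.
Qed.

Lemma code_le b : code b <= 3 / 2.
Proof.
apply: limr_le; first exact: is_cvg_code_part.
by apply: nearW => n; exact: code_part_le.
Qed.

Lemma codeS b : code b = (b 0)%:R + code (b \o S) / 3.
Proof.
apply/cvg_lim => //; rewrite -(cvg_shiftS (code_part b)).
under eq_fun do rewrite code_partS.
by apply: cvgD; [exact: cvg_cst|apply: cvgM; [exact: is_cvg_code_part|exact: cvg_cst]].
Qed.

Definition digit x : bool := 1 <= x.
Definition drop_digit x : R := 3 * (x - (digit x)%:R).
Definition decode x (n : nat) : bool := digit (iter n drop_digit x).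

Lemma digit_code b : digit (code b) = b 0.
Proof.
rewrite /digit codeS; have := code_ge0 (b \o S); have := code_le (b \o S).
by case: (b 0) => /=; lra.
Qed.

Lemma drop_digit_code b : drop_digit (code b) = code (b \o S).
Proof. by rewrite /drop_digit digit_code codeS; lra. Qed.

Lemma codeK b n : decode (code b) n = b n.
Proof.
rewrite /decode; elim: n b => [|n IH] b; first exact: digit_code.
by rewrite iterSr drop_digit_code IH.
Qed.

Lemma measurable_code d (T : measurableType d) (B : T -> nat -> bool) :
  (forall n, measurable_fun setT (B ^~ n)) ->
  measurable_fun setT (code \o B).
Proof.
move=> mB; apply: (@measurable_fun_cvg _ _ _ _ (fun n t => code_part (B t) n)).
  move=> n; apply: measurable_sum => k.
  by apply: measurable_funM => //; exact: (measurableT_comp measurable_bool_natr (mB k)).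
by move=> t _; exact: is_cvg_code_part.
Qed.

Lemma measurable_decode n : measurable_fun setT (decode ^~ n).
Proof.
have mdigit : measurable_fun setT digit by exact: measurable_fun_ler.
apply: measurableT_comp => //; elim: n => [|n IH] /=; first exact: measurable_id.
apply: (measurableT_comp (f := drop_digit)) => //.
apply: measurable_funM => //; apply: measurable_funB => //.
exact: (measurableT_comp measurable_bool_natr mdigit).
Qed.

End ternary_code.

Section pair_retract.
Context (R : realType).

Let bits (z : R * R) (n : nat) : bool :=
  rat_seq R n./2 < (if odd n then z.2 else z.1).

Let decut (c : bool) (x : R) : R :=
  fine (cut_sup R [set n | decode x (c + n.*2)]).

(** A pair of reals is coded by its two sequences of rational cuts, interleaved
    into one sequence of bits, which is then coded by a real number. *)
Lemma pair_retract : ereal_retract R (R * R)%type.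
Proof.
have bitsK c z : decut c (code R (bits z)) = if c then z.2 else z.1.
  rewrite -[RHS]/(fine (_%:E)) -cut_supK; congr (fine (cut_sup _ _)).
  apply/seteqP; split => n; rewrite /= codeK /bits oddD odd_double addbF.
    by case: c; rewrite /= ?add0n ?doubleK ?uphalf_double.
  by case: c; rewrite /= ?add0n ?doubleK ?uphalf_double.
have mdecut c : measurable_fun setT (decut c).
  apply: measurableT_comp => //; apply: measurable_cut_sup => n.
  rewrite -[X in measurable X]setTI.
  exact: (@measurable_decode R (c + n.*2) measurableT [set true]).
exists (EFin \o code R \o bits), ((fun x => (decut false x, decut true x)) \o fine).
split.
- apply/measurable_EFinP/measurable_code => n.
  apply: measurable_fun_ltr => //.
  by case: (odd n); [exact: measurable_snd|exact: measurable_fst].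
- by apply: measurableT_comp => //; exact: measurable_fun_pair.
- by move=> [x y] /=; rewrite !bitsK.
Qed.

End pair_retract.

(** * An i.i.d. sequence of uniform variables *)

(** Noise outsourcing for a pair of independent uniform variables given no
    information, i.e. given a variable with a single value. *)
Lemma exists_uniform_split (R : realType) : exists s : R -> R * R,
  measurable_fun setT s /\
  forall D, measurable D -> unif01 R (s @^-1` D) = (unif01 R \x unif01 R)%E D.
Proof.
pose P : probability (R * R)%type R := (unif01 R \x unif01 R)%E.
pose V : {RV P >-> unit} := cst tt.
have [g [mg gE]] := noise_outsourcing V (@measurable_id _ _ setT) (pair_retract R).
exists (fun u => g (tt, u)); split.
  by apply: measurableT_comp => //; exact: pair1_measurable.
move=> D mD; have mD' := measurable_preimageT (@measurable_snd _ _ unit _) mD.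
rewrite [RHS](gE _ mD').
rewrite (_ : _ @^-1` _ = setT `*` [set u | D (g (tt, u))]); last first.
  by apply/seteqP; split => [[[] u]|[[] u] []].
have mgD : measurable [set u | D (g (tt, u))].
  apply: (measurable_preimageT (f := fun u => g (tt, u))) mD.
  by apply: measurableT_comp => //; exact: pair1_measurable.
by rewrite [RHS]product_measure1E// [X in (X * _)%E]probability_setT mul1e.
Qed.

Section iid_uniform.
Context (R : realType) (s : R -> R * R) (ms : measurable_fun setT s)
  (s_law : forall D, measurable D ->
    unif01 R (s @^-1` D) = (unif01 R \x unif01 R)%E D).

Local Notation U := (unif01 R).

Definition reservoir (n : nat) : R -> R := iter n (snd \o s).
Definition luck (n : nat) : R -> R := fst \o s \o reservoir n.

Lemma measurable_reservoir n : measurable_fun setT (reservoir n).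
Proof.
elim: n => [|n IH]; first exact: measurable_id.
exact: (measurableT_comp (measurableT_comp measurable_snd ms) IH).
Qed.

Lemma measurable_luck n : measurable_fun setT (luck n).
Proof.
exact: (measurableT_comp (measurableT_comp measurable_fst ms) (measurable_reservoir n)).
Qed.

HB.instance Definition _ n :=
  isMeasurableFun.Build _ _ _ _ (luck n) (measurable_luck n).

Definition luck_rv (n : nat) : {RV U >-> R} := luck n.

(** The event on the reservoir is there to make the induction work: it is uniform and
    independent of all luck drawn so far, and splitting it preserves this. *)
Lemma luck_box (B : nat -> set R) n (C : set R) :
  (forall i, measurable (B i)) -> measurable C ->
  U (\bigcap_(i < n) (luck i @^-1` B i) `&` reservoir n @^-1` C)
    = (\prod_(i < n) U (B i) * U C)%E.
Proof.
move=> mB; elim: n C => [|n IH] C mC.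
  by rewrite big_ord0 mul1e bigcap_mkord big_ord0 setTI.
have mBC : measurable (B n `*` C) by exact: measurableX.
have mP : measurable (s @^-1` (B n `*` C)) by exact: measurable_preimageT mBC.
transitivity (U (\bigcap_(i < n) (luck i @^-1` B i) `&`
    reservoir n @^-1` (s @^-1` (B n `*` C)))).
  by rewrite !bigcap_mkord big_ord_recr/= -setIA.
by rewrite IH// s_law// product_measure1E// big_ord_recr/= muleA.
Qed.

Lemma reservoir_law n (C : set R) : measurable C -> U (reservoir n @^-1` C) = U C.
Proof.
move=> mC; have := @luck_box (fun=> setT) n C (fun=> measurableT) mC.
rewrite bigcapT ?setTI; last by move=> i _; exact: preimage_setT.
move=> ->.
by rewrite big1 ?mul1e// => i _; exact: probability_setT.
Qed.

Lemma luck_law n (B : set R) : measurable B -> U (luck n @^-1` B) = U B.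
Proof.
move=> mB.
have mBT : measurable (B `*` [set: R]) by exact: measurableX.
rewrite (_ : luck n @^-1` B = reservoir n @^-1` (s @^-1` (B `*` setT))); last first.
  by apply/seteqP; split => x //= [].
rewrite reservoir_law; last exact: measurable_preimageT.
by rewrite s_law// product_measure1E// [X in (_ * X)%E]probability_setT mule1.
Qed.

Lemma luck_iid : iid luck_rv.
Proof.
split; last by move=> i j B mB; rewrite /distribution /pushforward !luck_law.
move=> J B mB; pose n := (\max_(i <- J) i).+1.
(* Pad the family with the whole space to reach an initial segment of nat. *)
pose B' i := if i \in J then B i else setT.
have mB' i : measurable (B' i) by rewrite /B'; case: ifP.
have Jn i : i \in J -> (i < n)%N by move=> iJ; rewrite ltnS; exact: leq_bigmax_seq.
transitivity (U (\bigcap_(i < n) (luck i @^-1` B' i) `&` reservoir n @^-1` setT)).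
  rewrite preimage_setT setIT; congr (U _); apply/seteqP; split => x /= Bx i.
    by move=> _; rewrite /B' /preimage /=; case: ifPn => // iJ; exact: Bx.
  by move=> /= iJ; have := Bx i (Jn i iJ); rewrite /B' /= iJ.
rewrite luck_box// probability_setT mule1.
rewrite -(big_mkord xpredT (fun i => U (B' i))) /index_iota subn0.
transitivity (\prod_(i <- iota 0 n | i \in J) U (B i))%E.
  rewrite [RHS]big_mkcond/=; apply: eq_bigr => i _; rewrite /B'.
  by case: ifP => // _; exact: probability_setT.
rewrite -big_filter; transitivity (\prod_(i <- J) U (B i))%E.
  apply: perm_big; apply: uniq_perm; [by rewrite filter_uniq ?iota_uniq|exact: fset_uniq|].
  move=> i; rewrite mem_filter mem_iota add0n leq0n /=.
  by apply/andb_idr; exact: Jn.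
by apply: eq_bigr => i _; rewrite luck_law.
Qed.

End iid_uniform.

(** * Finite histories determine the law of a sequence *)

Section history.
Context d (E : measurableType d).

Definition snoc n (t : n.-tuple E) (e : E) : n.+1.-tuple E := [tuple of rcons t e].

Lemma measurable_snoc n : measurable_fun setT (fun z : n.-tuple E * E => snoc z.1 z.2).
Proof.
apply/measurable_fun_tnthP => i.
have [iltn|nlei] := ltnP i n.
  rewrite (_ : _ \o _ = fun z : n.-tuple E * E => tnth z.1 (Ordinal iltn)).
    exact: (measurableT_comp (measurable_tnth (Ordinal iltn))).
  apply/funext => -[t e] /=.
  by rewrite !(tnth_nth e) /= nth_rcons size_tuple iltn.
rewrite (_ : _ \o _ = snd) //; apply/funext => -[t e] /=.
have iE : i = n :> nat by apply/eqP; rewrite eqn_leq nlei -ltnS ltn_ord.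
by rewrite (tnth_nth e) /= nth_rcons size_tuple iE ltnn eqxx.
Qed.

Lemma mktupleS (y : nat -> E) n :
  [tuple y i | i < n.+1] = snoc [tuple y i | i < n] (y n).
Proof.
apply: eq_from_tnth => i; rewrite tnth_mktuple (tnth_nth (y 0)).
rewrite -[tval (snoc _ _)]/(rcons _ _) nth_rcons size_tuple.
have [iltn|nlei] := ltnP i n.
  by rewrite -(tnth_nth _ _ (Ordinal iltn)) tnth_mktuple.
have iE : i = n :> nat by apply/eqP; rewrite eqn_leq nlei -ltnS ltn_ord.
by rewrite iE eqxx.
Qed.

End history.

Section boxes.
Context d (E : measurableType d).

(** Only the first n coordinates are constrained.  Indexing B by all of nat makes
    intersections coordinatewise, with no need to match the dimensions. *)
Definition boxes : set (set (seq_space E)) :=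
  [set A | exists n (B : nat -> set E), [/\ forall i, measurable (B i),
     forall i, (n <= i)%N -> B i = setT & A = [set s | forall i, B i (s i)]]].

Lemma measurable_coord (i : nat) : measurable_fun setT (fun s : seq_space E => s i).
Proof.
move=> _ B mB; rewrite setTI; apply: sub_sigma_algebra.
by exists i, B.
Qed.

Lemma measurable_path_of d' (T : measurableType d') (X : nat -> T -> E) :
  (forall n, measurable_fun setT (X n)) -> measurable_fun setT (path_of X).
Proof.
move=> mX mT; apply: (@measurability _ _ _ (seq_space E) _ _ (@coordinate_sets _ E)) => //.
by move=> _ [_ [n [B [mB ->]]] <-]; rewrite setTI; exact: (measurable_preimageT (mX n) mB).
Qed.

Lemma boxes_setI : setI_closed boxes.
Proof.
move=> _ _ [n [B [mB BT ->]]] [n' [B' [mB' BT' ->]]].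
exists (maxn n n'), (fun i => B i `&` B' i); split.
- by move=> i; exact: measurableI.
- by move=> i; rewrite geq_max => /andP[ni n'i]; rewrite BT// BT'// setTI.
- apply/seteqP; split => s /=; first by move=> [Bs B's] i.
  by move=> BB's; split => i; case: (BB's i).
Qed.

Lemma measurable_boxes : @measurable _ (seq_space E) = <<s boxes >>.
Proof.
apply/seteqP; split; apply: smallest_sub.
- exact: smallest_sigma_algebra.
- move=> _ [n [B [mB ->]]]; apply: sub_sigma_algebra.
  exists n.+1, (fun i => if i == n then B else setT); split.
  + by move=> i; case: ifP.
  + by move=> i ni; rewrite gtn_eqF.
  + apply/seteqP; split => s /=; last by move=> /(_ n); rewrite eqxx.
    by move=> Bs i; case: eqP => // ->.
- exact: sigma_algebra_measurable.
- move=> _ [n [B [mB _ ->]]].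
  rewrite (_ : [set _ | _] = \bigcap_i ((fun s : seq_space E => s i) @^-1` B i)).
    apply: bigcap_measurable => // i _; exact: measurable_preimageT (measurable_coord i) (mB i).
  by apply/seteqP; split => s /= Bs i; [move=> _|]; exact: Bs.
Qed.

Lemma measurable_tuple_box (B : nat -> set E) n : (forall i, measurable (B i)) ->
  measurable [set t : n.-tuple E | forall i : 'I_n, B i (tnth t i)].
Proof.
move=> mB.
rewrite (_ : [set _ | _] = \bigcap_(i in [set: 'I_n])
    ((fun t : n.-tuple E => tnth t i) @^-1` B i)).
  apply: fin_bigcap_measurable => // i _.
  exact: measurable_preimageT (measurable_tnth i) (mB i).
by apply/seteqP; split => s /= Bs i; [move=> _|]; exact: Bs.
Qed.

Lemma box_history (B : nat -> set E) n (y : nat -> E) :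
  (forall i, (n <= i)%N -> B i = setT) ->
  (forall i, B i (y i)) <->
  (forall i : 'I_n, B i (tnth [tuple y i | i < n] i)).
Proof.
move=> BT; split=> By i; first by rewrite tnth_mktuple.
have [iltn|/BT->//] := ltnP i n.
by have := By (Ordinal iltn); rewrite tnth_mktuple.
Qed.

Lemma same_law_history (R : realType)
    d1 (T1 : measurableType d1) (P1 : probability T1 R) (Y1 : nat -> T1 -> E)
    d2 (T2 : measurableType d2) (P2 : probability T2 R) (Y2 : nat -> T2 -> E) :
  (forall n, measurable_fun setT (Y1 n)) ->
  (forall n, measurable_fun setT (Y2 n)) ->
  (forall n (A : set (n.-tuple E)), measurable A ->
    P1 ((fun w => [tuple Y1 i w | i < n]) @^-1` A)
    = P2 ((fun w => [tuple Y2 i w | i < n]) @^-1` A)) ->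
  same_joint_distribution P1 Y1 P2 Y2.
Proof.
move=> mY1 mY2 Y12; apply: (same_law_pi_system (measurable_path_of mY1)
  (measurable_path_of mY2) measurable_boxes boxes_setI).
move=> _ [n [B [mB BT ->]]].
have boxE T (Y : nat -> T -> E) : path_of Y @^-1` [set s | forall i, B i (s i)]
    = (fun w => [tuple Y i w | i < n]) @^-1`
      [set t : n.-tuple E | forall i : 'I_n, B i (tnth t i)].
  by apply/seteqP; split => w /=; move/(box_history (Y ^~ w) BT).
by rewrite !boxE Y12//; exact: measurable_tuple_box.
Qed.

End boxes.

(** * Simulation from the past *)

Section path_construction.
Context (R : realType) d (E : measurableType d) (E_retract : ereal_retract R E)
  d' (Om : measurableType d') (P : probability Om R) (Y : nat -> Om -> E)
  (mY : forall n, measurable_fun setT (Y n)).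

Local Notation U := (unif01 R).

Definition past n (w : Om) : n.-tuple E := [tuple Y i w | i < n].

Lemma measurable_past n : measurable_fun setT (past n).
Proof.
apply/measurable_fun_tnthP => i.
by rewrite (_ : _ \o _ = Y i)//; apply/funext => w /=; rewrite tnth_mktuple.
Qed.

HB.instance Definition _ n :=
  isMeasurableFun.Build _ _ _ _ (past n) (@measurable_past n).

Definition past_rv n : {RV P >-> n.-tuple E} := past n.

Definition split_spec := cid (exists_uniform_split R).
Definition split_fun := sval split_spec.

Lemma measurable_split_fun : measurable_fun setT split_fun.
Proof. by rewrite /split_fun; case: split_spec => s []. Qed.

Lemma split_fun_law D : measurable D -> U (split_fun @^-1` D) = (U \x U)%E D.
Proof. by rewrite /split_fun; case: split_spec => s /= [_ sE]; exact: sE. Qed.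

Definition update_spec n :=
  cid (noise_outsourcing (past_rv n) (mY n) E_retract).
Definition update n : n.-tuple E * R -> E := sval (update_spec n).

Lemma measurable_update n : measurable_fun setT (@update n).
Proof. by rewrite /update; case: update_spec => g []. Qed.

Lemma update_law n D : measurable D ->
  P ((fun w => (past n w, Y n w)) @^-1` D)
  = (distribution P (past_rv n) \x U)%E ((fun z => (z.1, update z)) @^-1` D).
Proof. by rewrite /update; case: update_spec => g /= [_ gE]; exact: gE. Qed.

Local Notation X := (luck split_fun).
Local Notation W := (reservoir split_fun).

Fixpoint sim_past n (w : R) : n.-tuple E :=
  if n is m.+1 then snoc (sim_past m w) (update (sim_past m w, X m w))
  else [tuple].

Definition sim n (w : R) : E := update (sim_past n w, X n w).

Lemma sim_pastE n w : sim_past n w = [tuple sim i w | i < n].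
Proof.
elim: n => [|n IH]; first by rewrite [RHS]tuple0.
by rewrite (mktupleS (sim ^~ w)) -IH.
Qed.

Lemma measurable_sim_past n : measurable_fun setT (sim_past n).
Proof.
elim: n => [|n IH] /=; first exact: measurable_cst.
apply: (measurableT_comp (@measurable_snoc _ E n)
  (g := fun w => (sim_past n w, update (sim_past n w, X n w)))).
apply: measurable_fun_pair => //.
apply: (measurableT_comp (@measurable_update n) (g := fun w => (sim_past n w, X n w))).
apply: measurable_fun_pair => //.
exact: measurable_luck measurable_split_fun n.
Qed.

Lemma measurable_sim n : measurable_fun setT (sim n).
Proof.
apply: (measurableT_comp (@measurable_update n) (g := fun w => (sim_past n w, X n w))).
apply: measurable_fun_pair; first exact: measurable_sim_past.
exact: measurable_luck measurable_split_fun n.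
Qed.

(** The simulated past is independent of the reservoir, which is what allows the
    next step: the split turns the reservoir into a fresh uniform variable, which
    the update combines with the past, and a new reservoir independent of both. *)
Lemma sim_past_law n D : measurable D ->
  U ((fun w => (sim_past n w, W n w)) @^-1` D)
  = (distribution P (past_rv n) \x U)%E D.
Proof.
have mWn := @measurable_reservoir R _ measurable_split_fun.
elim: n D => [|n IH] D mD.
  move: D mD; apply: (same_law_prod (P2 := (distribution P (past_rv 0) \x U)%E)
    (X2 := id)) => [| |A B mA mB].
  - by apply: measurable_fun_pair; [exact: (@measurable_sim_past 0)|exact: (mWn 0)].
  - exact: measurable_id.
  rewrite [RHS]product_measure1E// -[X in _ = (X * _)%E]/(P (past 0 @^-1` A)).
  have [A0|nA0] := pselect (A [tuple]).
    rewrite (_ : past 0 @^-1` A = setT) ?probability_setT ?mul1e.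
      by congr (U _); apply/seteqP; split => w // [].
    by apply/seteqP; split => w //= _; rewrite [past _ _]tuple0.
  rewrite (_ : past 0 @^-1` A = set0) ?measure0 ?mul0e.
    by rewrite -[RHS](measure0 U); congr (U _); apply/seteqP; split => w // [].
  by apply/seteqP; split => w //=; rewrite [past _ _]tuple0.
move: D mD; apply: (same_law_prod (P2 := (distribution P (past_rv n.+1) \x U)%E)
    (X2 := id)) => [| |A B mA mB].
- by apply: measurable_fun_pair; [exact: (@measurable_sim_past n.+1)|exact: (mWn n.+1)].
- exact: measurable_id.
have mupd : measurable_fun setT
    (fun z : n.-tuple E * R => snoc z.1 (update z)).
  apply: (measurableT_comp (@measurable_snoc _ E n) (g := fun z => (z.1, update z))).
  by apply: measurable_fun_pair => //; exact: measurable_update.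
pose K := [set z : n.-tuple E * R | A (snoc z.1 (update z))].
have mK : measurable K by exact: measurable_preimageT mupd mA.
(* H is the event of step n+1 in terms of the past and the reservoir of step n. *)
pose H := [set z : n.-tuple E * R | (xsection K z.1 `*` B) (split_fun z.2)].
have mH : measurable H.
  pose h (z : n.-tuple E * R) := ((z.1, (split_fun z.2).1), (split_fun z.2).2).
  have ms2 : measurable_fun setT (fun z : n.-tuple E * R => split_fun z.2).
    exact: (measurableT_comp measurable_split_fun).
  have mh : measurable_fun setT h.
    apply: measurable_fun_pair; last exact: (measurableT_comp measurable_snd ms2).
    by apply: measurable_fun_pair => //; exact: (measurableT_comp measurable_fst ms2).
  rewrite (_ : H = h @^-1` (K `*` B)).
    by apply: (measurable_preimageT mh); exact: measurableX.
  by apply/seteqP; split => z; rewrite /H /h /xsection /= inE.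
transitivity ((distribution P (past_rv n) \x U)%E H).
  rewrite -IH//; congr (U _).
  by apply/seteqP; split => w; rewrite /H /xsection /= inE.
rewrite [RHS]product_measure1E//.
transitivity ((distribution P (past_rv n) \x U)%E K * U B)%E.
  rewrite /product_measure1 -ge0_integralZr//; last exact: measurable_fun_xsection.
  apply: eq_integral => v _.
  rewrite -[LHS]/(U (xsection H v)) -[RHS]/(U (xsection K v) * U B)%E.
  have HvE : xsection H v = split_fun @^-1` (xsection K v `*` B).
    by apply/seteqP; split => u; [move=> /set_mem|move=> Hu; apply/mem_set].
  have mKv : measurable (xsection K v) by exact: measurable_xsection.
  by rewrite HvE split_fun_law ?product_measure1E//; exact: measurableX.
congr (_ * _)%E.
have mD : measurable [set z : n.-tuple E * E | A (snoc z.1 z.2)].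
  exact: measurable_preimageT (@measurable_snoc _ E n) mA.
rewrite -[LHS](update_law mD); congr (P _).
by apply/seteqP; split => w /=; rewrite /past_rv /= /past (mktupleS (Y ^~ w)).
Qed.

Lemma sim_law : same_joint_distribution P Y U sim.
Proof.
apply: same_law_history => // [|n A mA]; first exact: measurable_sim.
have mAT : measurable (A `*` [set: R]) by exact: measurableX.
transitivity (U ((fun w => (sim_past n w, W n w)) @^-1` (A `*` setT))).
  by rewrite sim_past_law// product_measure1E// [X in (_ * X)%E]probability_setT mule1.
congr (U _); apply/seteqP; split => w /=; rewrite sim_pastE => //.
by case.
Qed.

(** Any process in E, exchangeable or not, has a path dependent version. *)
Lemma exists_path_model : exists M : path_model R E,
  same_joint_distribution P Y (pm_P M) (pm_Y M).
Proof.
have simE n w : sim n w = update ([tuple sim i w | i < n], X n w).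
  by rewrite -sim_pastE.
exists (PathModel (luck_iid measurable_split_fun split_fun_law)
  measurable_update simE).
exact: sim_law.
Qed.

End path_construction.

Theorem theorem2 (R : realType) (d : measure_display) (E : measurableType d)
    (E_standard : standard_borel R E) (M : talent_model R E) :
  exists M' : path_model R E,
    same_joint_distribution (tm_P M) (tm_Y M)
                            (pm_P M') (pm_Y M').
Proof.
have E_retract := standard_borel_retract E_standard.
have mY n : measurable_fun setT (tm_Y M n).
  have mTX : measurable_fun setT (fun w => (tm_T M w, tm_X M n w)).
    by apply: measurable_fun_pair; exact: measurable_funPT.
  exact: (measurableT_comp (@tm_f_measurable _ _ _ M) mTX).
exact: (exists_path_model E_retract (tm_P M) mY).
Qed.
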